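(* The cycle index of the $3$-group $S_8^{(3)}$ of the symmetric group $S_8$, i.e. of the action of $S_8$ on the $56$ three-element subsets of $\{1,\dots,8\}$, in the variables $a_1,a_2,\dots$, is \begin{align*} Z(S_8^{(3)}) = \frac{1}{8!} \big(& a_{1}^{56} + 28 a_{1}^{26} a_{2}^{15} + 210 a_{1}^{12} a_{2}^{22} + 112 a_{1}^{11} a_{3}^{15} + 420 a_{1}^{6} a_{2}^{25} \\ & + 1120 a_{1}^{5} a_{2}^{3} a_{3}^{7} a_{6}^{4} + 420 a_{1}^{4} a_{2}^{4} a_{4}^{11} + 1680 a_{1}^{3} a_{2}^{4} a_{3}^{3} a_{6}^{6} + 2520 a_{1}^{2} a_{2}^{5} a_{4}^{11} \\ & + 1120 a_{1}^{2} a_{3}^{18} + 1120 a_{1}^{2} a_{3}^{8} a_{6}^{5} + 4032 a_{1} a_{5}^{5} a_{10}^{3} + 3360 a_{1} a_{2} a_{3} a_{4}^{2} a_{6} a_{12}^{3} \\ & + 2688 a_{1} a_{5}^{2} a_{15}^{3} + 1344 a_{1} a_{5}^{11} + 105 a_{2}^{28} + 1260 a_{2}^{6} a_{4}^{11} + 3360 a_{2} a_{3}^{2} a_{6}^{8} \\ & + 3360 a_{2} a_{6}^{9} + 1260 a_{4}^{14} + 5760 a_{7}^{8} + 5040 a_{8}^{7}\big). \end{align*}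
   Context: For a permutation group $A$ on a finite set, and $\alpha\in A$, let $j_k(\alpha)$ be the number of cycles of length $k$ in the disjoint cycle decomposition of $\alpha$ (fixed points counted as cycles of length $1$). The cycle index of $A$ is the polynomial $Z(A)=\frac{1}{|A|}\sum_{\alpha\in A}\prod_{k} a_k^{j_k(\alpha)}$ in the variables $a_1,a_2,\dots$ with rational coefficients. For $1\le r\le p$, $S_p^{(r)}$ (the $r$-group of $S_p$) is the permutation group on the set of $r$-element subsets of $\{1,\dots,p\}$ formed by the permutations $\alpha'$ induced by $\alpha\in S_p$ via $\alpha'\{i_1,\dots,i_r\}=\{\alpha i_1,\dots,\alpha i_r\}$. *)

(* Defs.v *)
From mathcomp Require Import all_boot all_order all_algebra all_fingroup.
From mathcomp Require Import finmap.
From mathcomp Require Import monalg.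

Set Implicit Arguments.
Unset Strict Implicit.
Unset Printing Implicit Defensive.

Import GRing.Theory.
Local Open Scope ring_scope.

(* Rational polynomials in infinitely many commuting variables a_0, a_1, ...;
   a_0 is never used by the cycle index. *)
Notation cycpoly := {malg rat[{cmonom nat}]}.

Definition a (k : nat) : cycpoly := << ucm k >>.

(* Fixed points are the singletons of [porbits s], hence cycles of length 1. *)
Definition ncycles (T : finType) (k : nat) (s : {perm T}) : nat :=
  #|[set c in porbits s | #|c| == k]|.

(* No cycle is longer than #|T|, so the product over all k >= 1 may stop
   there. *)
Definition cycle_index (T : finType) (A : {group {perm T}}) : cycpoly :=
  (#|A|%:R^-1 : rat) *:
    \sum_(s in A) \prod_(1 <= k < #|T|.+1) a k ^+ ncycles k s.

Definition rsubset (p r : nat) : finType := {B : {set 'I_p} | #|B| == r}.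

Section InducedGroup.

Variables p r : nat.

Fact card_induced (s : {perm 'I_p}) (B : rsubset p r) :
  #|[set s i | i in val B]| == r.
Proof. by rewrite card_imset ?(valP B) //; apply: perm_inj. Qed.

Definition induced_fun (s : {perm 'I_p}) (B : rsubset p r) : rsubset p r :=
  Sub [set s i | i in val B] (card_induced s B).

Fact induced_inj (s : {perm 'I_p}) : injective (induced_fun s).
Proof.
by move=> B C /(congr1 val) /= /(imset_inj (@perm_inj _ s)) /val_inj.
Qed.

Definition induced (s : {perm 'I_p}) : {perm rsubset p r} :=
  perm (@induced_inj s).

Fact inducedM : {in [set: {perm 'I_p}] &, {morph induced : s t / (s * t)%g}}.
Proof.
move=> s t _ _; apply/permP => B; apply: val_inj; rewrite permM !permE /=.
by rewrite -imset_comp; apply: eq_imset => i; rewrite /= permM.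
Qed.

Definition induced_morphism := Morphism inducedM.

Definition rgroup : {group {perm rsubset p r}} :=
  [group of (induced_morphism @* [set: {perm 'I_p}])%g].

End InducedGroup.

(* Main.v *)
(* Let f_m be the number of fixed points of s^m on the ground set.  A 3-subset
   is fixed by s iff s permutes it, i.e. it consists of three fixed points, of
   a fixed point and a 2-cycle, or of a 3-cycle; hence s fixes
     (f_1 (f_1 - 1) (f_1 - 2) + 3 f_1 (f_2 - f_1) + 2 (f_3 - f_1)) / 6
   of them.  Applying this to the powers of s and inverting
   f_m = sum_(d | m) #(points in cycles of length d) on both levels, the cycle
   type of s determines that of the induced permutation.

   The permutations of each cycle type are counted by adding one point at a
   time: every permutation of D + x is uniquely s * (x y) with s supported by
   D and y in D + x, and for y <> x this inserts x in the cycle of y, so that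
   one cycle length k becomes k + 1. *)

Require Import Defs.
From mathcomp Require Import all_boot all_order all_algebra all_fingroup.
From mathcomp Require Import finmap zify.
From mathcomp Require Import monalg.

Set Implicit Arguments.
Unset Strict Implicit.
Unset Printing Implicit Defensive.

Import GRing.Theory.
Local Open Scope ring_scope.

(** * Points by length of cycle, and fixed points of powers *)

Section OrbitLengths.

Variable T : finType.
Implicit Types (s : {perm T}) (x y z : T) (k m : nat).

Definition orbit_count s k : nat := #|[set z | #|porbit s z| == k]|.

Definition fix_count s m : nat := #|[set z | (s ^+ m)%g z == z]|.

Lemma orbit_count_ncycles s k : orbit_count s k = (k * ncycles k s)%N.
Proof.
have triv : trivIset (porbits s).
  apply/trivIsetP => _ _ /imsetP[x _ ->] /imsetP[y _ ->]; apply: contraR.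
  case/pred0Pn => z /andP[/= zx zy].
  by move: zx zy; rewrite -!eq_porbit_mem => /eqP <- /eqP <-.
rewrite /orbit_count /ncycles.
have -> : [set z | #|porbit s z| == k]
          = cover [set c in porbits s | #|c| == k].
  apply/setP => z; rewrite inE; apply/idP/bigcupP => [zk | [c]].
    by exists (porbit s z); rewrite ?porbit_id // inE zk imset_f.
  rewrite inE => /andP[/imsetP[y _ ->] /eqP ck] zy.
  by move: zy; rewrite -eq_porbit_mem => /eqP ->; rewrite ck.
have /eqP <- : trivIset [set c in porbits s | #|c| == k].
  apply: trivIsetS triv; apply/subsetP => c; by rewrite inE => /andP[].
rewrite (eq_bigr (fun=> k)) => [|c]; first by rewrite sum_nat_const mulnC.
by rewrite inE => /andP[_ /eqP].
Qed.

Lemma orbit_count0 s : orbit_count s 0 = 0%N.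
Proof. by rewrite orbit_count_ncycles. Qed.

Lemma ncyclesE s k : ncycles k s = (orbit_count s k %/ k)%N.
Proof.
case: k => [|k]; last by rewrite orbit_count_ncycles mulKn.
(* Division by 0 gives 0, and indeed no cycle is empty. *)
rewrite divn0; apply/eqP; rewrite cards_eq0; apply/eqP/setP => c.
rewrite !inE; apply/negP => /andP[/imsetP[x _ ->]].
by rewrite cards_eq0 => /eqP/setP/(_ x); rewrite porbit_id inE.
Qed.

(** Only the remainder of [m] modulo the length of the cycle matters, and the iterates before the
    first return to [z] are pairwise distinct. *)
Lemma expg_fix s m z : ((s ^+ m)%g z == z) = (#|porbit s z| %| m)%N.
Proof.
set k := #|_|.
have k_gt0 : (0 < k)%N by apply/card_gt0P; exists z; apply: porbit_id.
have iter_k q : iter (q * k) s z = z.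
  by elim: q => // q IHq; rewrite mulSn iterD IHq iter_porbit.
rewrite permX {1}(divn_eq m k) addnC iterD iter_k /dvdn.
have lt_mk : (m %% k < k)%N by rewrite ltn_mod.
have := nth_uniq z (i := m %% k) (j := 0) _ _ (uniq_traject_porbit s z).
by rewrite !size_traject => <- //; rewrite !nth_traject.
Qed.

(* Only the lengths [d <= m] and [d <= #|T|] can occur, whence the choice of
   the bound [n]. *)
Lemma fix_countE s m n : (0 < m)%N -> (minn m #|T| < n)%N ->
  fix_count s m = (\sum_(d < n | (d %| m)%N) orbit_count s d)%N.
Proof.
move=> m_gt0 lt_n.
rewrite /fix_count -sum1_card big_mkcond /= /orbit_count.
under [RHS]eq_bigr do rewrite -sum1_card big_mkcond /=.
rewrite exchange_big /=; apply: eq_bigr => z _; rewrite inE expg_fix.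
under eq_bigr do rewrite inE.
rewrite -big_mkcondr /=.
case: ifP => [dz | ndz].
  have lt_z : (#|porbit s z| < n)%N.
    apply: leq_ltn_trans lt_n; rewrite leq_min max_card andbT.
    exact: dvdn_leq.
  rewrite (big_pred1 (Ordinal lt_z)) // => d /=.
  rewrite -val_eqE /= eq_sym.
  by case: eqP => [-> | _]; rewrite ?dz ?andbT ?andbF.
rewrite big_pred0 // => d; apply/negP => /andP[dm /eqP zd].
by rewrite zd dm in ndz.
Qed.

End OrbitLengths.

(** * Insertion of a point into a cycle *)

Section Insertion.

Variable T : finType.
Implicit Types (s : {perm T}) (x y z : T) (k : nat).

Lemma insert_permE s x y z : s x = x -> x != y ->
  (s * tperm x y)%g z = if z == x then y else if s z == y then x else s z.
Proof.
move=> sx xy; rewrite permM; case: eqP => [-> | /eqP zx].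
  by rewrite sx tpermL.
case: tpermP => [szx | -> | _ /eqP/negbTE->] //; last by rewrite eqxx.
by case/eqP: zx; apply: (@perm_inj _ s); rewrite szx sx.
Qed.

Lemma porbit_fix s x : s x = x -> porbit s x = [set x].
Proof.
move=> sx; apply/setP => z; rewrite inE; apply/porbitP/eqP => [[i ->] | ->].
  by rewrite permX; elim: i => //= i ->.
by exists 0%N; rewrite perm1.
Qed.

(** The product follows the cycle of [y] as [s] does, except that it visits [x] just before
    returning to [y]. The other cycles contain neither point and do not change. *)
Lemma porbit_insert s x y : s x = x -> x != y ->
  forall z, porbit (s * tperm x y)%g z =
  if z \in x |: porbit s y then x |: porbit s y else porbit s z.
Proof.
move=> sx xy; set t := (_ * _)%g.
have tE z : t z = if z == x then y else if s z == y then x else s z.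
  exact: insert_permE.
have x_orb z : z != x -> x \notin porbit s z.
  by rewrite porbit_sym porbit_fix // inE.
have tx : porbit t x = x |: porbit s y.
  apply/setP => z; apply/porbitP/idP => [[i ->] | ].
    elim: i => [|i IHi]; first by rewrite perm1 setU11.
    rewrite expgSr permM tE.
    case: eqP => [_ | /eqP zx]; first by rewrite !inE porbit_id orbT.
    case: eqP => [_ | _]; first exact: setU11.
    move: IHi; rewrite !inE (negbTE zx) /= => /porbitP[j ->].
    by rewrite -permM -expgSr mem_porbit orbT.
  case/setU1P => [-> | /porbitP[i ->]]; first by exists 0%N; rewrite perm1.
  elim: i => [|i [j IHi]].
    by exists 1%N; rewrite expg1 perm1 tE eqxx.
  set w := (s ^+ i)%g y in IHi *.
  have wx : w != x.
    apply: contraNneq (x_orb y _) => [<- |]; last by rewrite eq_sym.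
    exact: mem_porbit.
  rewrite expgSr permM -/w.
  (* Where the cycle of [s] closes up, [t] goes to [x] instead; but [y] has already been reached, as
     [t x]. *)
  case: (eqVneq (s w) y) => [-> | swy].
    by exists 1%N; rewrite expg1 tE eqxx.
  by exists j.+1; rewrite expgSr permM -IHi tE (negbTE wx) (negbTE swy).
move=> z; case: ifPn => [zP | zNP].
  by rewrite -tx in zP *; apply/eqP; rewrite eq_porbit_mem.
have iterE i : (t ^+ i)%g z = (s ^+ i)%g z.
  elim: i => [|i IHi]; first by rewrite !perm1.
  rewrite expgSr permM IHi tE [in RHS]expgSr permM.
  move: zNP; rewrite !inE negb_or => /andP[zx zy].
  case: eqP => [wx | _].
    by case/negP: (x_orb z zx); rewrite -wx mem_porbit.
  case: eqP => // wy; case/negP: zy.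
  by rewrite porbit_sym -wy -permM -expgSr mem_porbit.
by apply/setP => w; apply/porbitP/porbitP => -[i ->]; exists i.
Qed.

(** The point [x] leaves length 1, the [l] points of the cycle of [y] leave length [l], and all of
    them get length [l.+1]. The points taken away are distinct and counted in [orbit_count s k], so
    no subtraction is truncated. *)
Lemma orbit_count_insert s x y k : s x = x -> x != y ->
  let l := #|porbit s y| in
  orbit_count (s * tperm x y)%g k =
  (orbit_count s k + l.+1 * (k == l.+1) - (k == 1) - l * (k == l))%N.
Proof.
move=> sx xy l; set P := x |: porbit s y.
have xNy : x \notin porbit s y by rewrite porbit_sym porbit_fix // inE eq_sym.
have countE u : orbit_count u k = (\sum_(z in P) (#|porbit u z| == k)
    + \sum_(z | z \notin P) (#|porbit u z| == k))%N.
  rewrite /orbit_count -sum1_card big_mkcond /= (bigID (mem P)) /=.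
  by congr addn; apply: eq_bigr => z _; rewrite inE; case: eqP.
rewrite !countE.
under eq_bigr => z zP do rewrite porbit_insert // zP.
rewrite sum_nat_const cardsU1 xNy -/l add1n (eq_sym _ k).
under [X in (_ + X)%N]eq_bigr => z zP do rewrite porbit_insert // (negbTE zP).
set R := (\sum_(z | z \notin P) _)%N.
rewrite /P big_setU1 //= porbit_fix // cards1.
under [in RHS]eq_bigr => z zP.
  move: zP; rewrite -eq_porbit_mem => /eqP ->; over.
rewrite sum_nat_const -/l (eq_sym 1 k) (eq_sym l k).
lia.
Qed.

Lemma big_perm_onU1 (V : nmodType) (D : {set T}) x (F : {perm T} -> V) :
  x \notin D ->
  \sum_(s | perm_on (x |: D) s) F s =
  \sum_(s | perm_on D s) (F s + \sum_(y in D) F (s * tperm x y)%g).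
Proof.
move=> xD; rewrite (partition_big (fun s => s x) [in x |: D]) /=; last first.
  by move=> s sD; rewrite (perm_closed _ sD) setU11.
rewrite [RHS](eq_bigr (fun s =>
  \sum_(y in x |: D) F (s * tperm x y)%g)); last first.
  by move=> s _; rewrite big_setU1 //= tperm1 mulg1.
rewrite [RHS]exchange_big /=; apply: eq_bigr => y yD.
rewrite (reindex_inj (mulIg (tperm x y))) /=; apply: eq_bigl => s.
apply/andP/idP => [[sD /eqP sy] | sD].
  have sx : s x = x.
    by apply: (@perm_inj _ (tperm x y)); rewrite -permM sy tpermL.
  have {}sD : perm_on (x |: D) s.
    rewrite -[s](mulgK (tperm x y)) tpermV; apply: perm_onM => //.
    apply: subset_trans (tperm_on x y) _.
    by apply/subsetP => z /set2P[->|->] //; apply: setU11.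
  apply/subsetP => z; rewrite inE => sz.
  by have /setU1P[zx | //] := subsetP sD z sz; rewrite zx sx eqxx in sz.
split; last by rewrite permM (out_perm sD xD) tpermL.
apply: perm_onM; first exact: subset_trans sD (subsetUr _ _).
apply: subset_trans (tperm_on x y) _.
by apply/subsetP => z /set2P[->|->] //; apply: setU11.
Qed.

End Insertion.

(** * Counting the stable 3-subsets of a permutation *)

Section StableTriples.

Variable T : finType.
Implicit Types (s : {perm T}) (x y z : T).

(* A stable set is fixed pointwise, or is a fixed point and a 2-cycle, or is a
   3-cycle; the six summands are the six permutations it may carry. *)
Lemma stable_triple_cases (f g : T -> T) x y z : cancel f g ->
  (uniq [:: x; y; z] &&
    [&& f x \in [:: x; y; z], f y \in [:: x; y; z] & f z \in [:: x; y; z]] =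
  [&& f x == x, f y == y, f z == z & uniq [:: x; y; z]]
  + [&& f x == x, f y == z, f y != y & f (f y) == y]
  + [&& f y == y, f z == x, f z != z & f (f z) == z]
  + [&& f z == z, f x == y, f x != x & f (f x) == x]
  + [&& f x == y, f (f x) == z, f x != x & f (f (f x)) == x]
  + [&& f x == z, f (f x) == y, f x != x & f (f (f x)) == x] :> nat)%N.
Proof.
move=> fK.
(* These six instances of [fK] give [congruence] the injectivity of [f] that it needs. *)
have:= fK x; have:= fK y; have:= fK z.
have:= fK (f x); have:= fK (f y); have:= fK (f z) => {fK} ? ? ? ? ? ?.
have uniqP : reflect [/\ x <> y, x <> z & y <> z] (uniq [:: x; y; z]).
  by rewrite /= !inE negb_or andbT -andbA; apply: (iffP and3P) => -[];
    do 3! move/eqP => ?.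
(* Each of the last five patterns forces the three points to be distinct, so without distinctness
   both sides vanish. *)
case: uniqP => [[xy xz yz] | nU]; last first.
  rewrite !andbF andFb.
  by do 5! (case: and4P => [[/eqP ? /eqP ? /eqP ? /eqP ?] | _];
    first by case: nU; split; congruence).
rewrite /= !inE !andbT.
case: (f x =P x) => ? /=; try case: (f x =P y) => ? /=;
  try case: (f x =P z) => ? /=; try congruence.
all: case: (f y =P y) => ? /=; try case: (f y =P z) => ? /=;
  try case: (f y =P x) => ? /=; try congruence.
all: try case: (f z =P z) => ? /=; try case: (f z =P x) => ? /=;
  try case: (f z =P y) => ? /=; try congruence.
all: by do ? (case: eqP => ? /=; try by exfalso; congruence).
Qed.

(** Serves twice: for a 3-set, which has six orderings, and for the set of fixed points. *)
Lemma sum_distinct_triples (B : {set T}) :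
  (\sum_x \sum_y \sum_z
     [&& x \in B, y \in B, z \in B & uniq [:: x; y; z]] =
   #|B| * #|B|.-1 * #|B|.-2)%N.
Proof.
transitivity (\sum_(x in B) \sum_(y in B :\ x) \sum_(z in B :\ x :\ y) 1)%N.
  rewrite [RHS]big_mkcond; apply: eq_bigr => x _.
  case: (boolP (x \in B)) => xB; last first.
    by rewrite !big1 // => y _; rewrite big1.
  rewrite /= [RHS]big_mkcond; apply: eq_bigr => y _.
  case: ifPn => yB; last first.
    rewrite big1 // => z _; rewrite !inE /= in yB *.
    by case: eqP yB => //= [-> | _ /negbTE->]; rewrite ?eqxx ?andbF.
  rewrite [RHS]big_mkcond; apply: eq_bigr => z _ /=.
  move: yB; rewrite !inE => /andP[yx ->]; rewrite (eq_sym x y) (negbTE yx) /=.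
  rewrite (eq_sym x z) (eq_sym y z).
  by case: (z == x); case: (z == y); case: (z \in B).
transitivity (\sum_(x in B) \sum_(y in B :\ x) #|B|.-2)%N.
  apply: eq_bigr => x xB; apply: eq_bigr => y yB; rewrite sum1_card.
  by rewrite (cardsD1 x B) xB (cardsD1 y (B :\ x)) yB.
transitivity (\sum_(x in B) #|B|.-1 * #|B|.-2)%N.
  apply: eq_bigr => x xB; rewrite sum_nat_const.
  by rewrite [in RHS](cardsD1 x B) xB [in LHS](cardsD1 x B) xB.
by rewrite sum_nat_const mulnA.
Qed.

Lemma cards3_uniq x y z : uniq [:: x; y; z] -> #|[set x; y; z]| = 3.
Proof.
rewrite /= !inE negb_or andbT => /andP[/andP[xy xz] yz].
by rewrite setUC cardsU1 !inE negb_or cards2 xy eq_sym xz eq_sym yz.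
Qed.

Lemma stable_set3 s x y z :
  (s @: [set x; y; z] == [set x; y; z]) =
  [&& s x \in [:: x; y; z], s y \in [:: x; y; z] & s z \in [:: x; y; z]].
Proof.
have memE w : (w \in [:: x; y; z]) = (w \in [set x; y; z]).
  by rewrite !inE orbA.
rewrite !memE eqEcard (card_imset _ perm_inj) leqnn andbT.
apply/idP/and3P => [/subsetP sub | [sx sy sz]].
  by split; apply: sub; apply: imset_f; rewrite !inE eqxx ?orbT.
apply/subsetP => _ /imsetP[w + ->].
by case/setUP => [/set2P[] | /set1P] ->.
Qed.

Lemma sum_eq_op x (c : pred T) : (\sum_y ((x == y) && c y) = c x :> nat)%N.
Proof.
rewrite (bigD1 x) //= eqxx big1 ?addn0 // => y yx.
by rewrite eq_sym (negbTE yx).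
Qed.

Lemma sum_pred_card (c : pred T) : (\sum_x c x = #|[set x | c x]|)%N.
Proof.
rewrite -sum1_card [RHS]big_mkcond; apply: eq_bigr => x _.
by rewrite inE; case: (c x).
Qed.

(** The two sets of fixed points are nested because [m] divides [n]. For [m = 1] and [n] prime, the
    points counted are those in cycles of length [n]. *)
Lemma card_exact_period s m n : (m %| n)%N ->
  #|[set z | ((s ^+ m)%g z != z) && ((s ^+ n)%g z == z)]|
  = (fix_count s n - fix_count s m)%N.
Proof.
move=> mn; rewrite /fix_count -cardsDS.
  by apply: eq_card => z; rewrite !inE.
apply/subsetP => z; rewrite !inE !expg_fix => /dvdn_trans; exact.
Qed.

(** Double counting of the ordered triples of distinct points whose underlying set is stable: by
    that set, with six orderings each, and by the six patterns of [stable_triple_cases]. *)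
Lemma card_stable_triples s (f := fix_count s) :
  (6 * #|[set B : {set T} | (#|B| == 3) && (s @: B == B)]| =
   f 1 * (f 1).-1 * (f 1).-2 + 3 * (f 1 * (f 2 - f 1)) + 2 * (f 3 - f 1))%N.
Proof.
transitivity (\sum_x \sum_y \sum_z (uniq [:: x; y; z] &&
  [&& s x \in [:: x; y; z], s y \in [:: x; y; z] & s z \in [:: x; y; z]]))%N.
  rewrite mulnC -sum_nat_const.
  transitivity (\sum_(B in [set C : {set T} | (#|C| == 3) && (s @: C == C)])
    \sum_x \sum_y \sum_z
      [&& x \in B, y \in B, z \in B & uniq [:: x; y; z]])%N.
    apply: eq_bigr => B; rewrite inE => /andP[/eqP B3 _].
    by rewrite sum_distinct_triples B3.
  rewrite exchange_big; apply: eq_bigr => x _.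
  rewrite exchange_big; apply: eq_bigr => y _.
  rewrite exchange_big; apply: eq_bigr => z _.
  rewrite -stable_set3.
  have [U | _] := boolP (uniq _); last first.
    by rewrite big1 // => B _; rewrite !andbF.
  (* Three distinct points lie in only one 3-set. *)
  rewrite (eq_bigr (fun B => ([set x; y; z] == B) : nat)) => [|B]; last first.
    rewrite inE => /andP[/eqP B3 _]; rewrite andbT eqEcard cards3_uniq // B3.
    congr nat_of_bool; apply/and3P/andP => [[xB yB zB] | [/subsetP sub _]].
      by split=> //; apply/subsetP => w /setUP[/set2P[]|/set1P] ->.
    by split; apply: sub; rewrite !inE eqxx ?orbT.
  rewrite big_mkcond (bigD1 [set x; y; z]) //= big1 => [|B Bn]; last first.
    by rewrite eq_sym (negbTE Bn); case: ifP.
  by rewrite inE cards3_uniq // !eqxx /=; case: eqP.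
have c1 : (\sum_x (s x == x) = f 1%N)%N.
  by rewrite sum_pred_card /f /fix_count; apply: eq_card => x; rewrite !inE.
have c2 : (\sum_x ((s x != x) && (s (s x) == x)) = f 2 - f 1)%N.
  rewrite sum_pred_card -card_exact_period //.
  by apply: eq_card => x; rewrite !inE !permX.
have c3 : (\sum_x ((s x != x) && (s (s (s x)) == x)) = f 3 - f 1)%N.
  rewrite sum_pred_card -card_exact_period //.
  by apply: eq_card => x; rewrite !inE !permX.
have sumM (c d : pred T) :
    (\sum_x \sum_y (c x && d y) = (\sum_x c x) * (\sum_y d y))%N.
  rewrite big_distrl; apply: eq_bigr => x _; rewrite big_distrr.
  by apply: eq_bigr => y _; rewrite /= mulnb.
under eq_bigr => x _ do under eq_bigr => y _ do under eq_bigr => z _ do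
  rewrite (stable_triple_cases _ _ _ (permK s)).
under eq_bigr => x _ do under eq_bigr => y _ do rewrite !big_split.
under eq_bigr => x _ do rewrite !big_split.
rewrite !big_split /=.
have -> : (\sum_x \sum_y \sum_z
    [&& s x == x, s y == y, s z == z & uniq [:: x; y; z]] =
    f 1 * (f 1).-1 * (f 1).-2)%N.
  rewrite -sum_distinct_triples.
  do 3! (apply: eq_bigr => ? _); by rewrite !inE.
have drop_eq A (w : T) C : (\sum_z [&& A, w == z & C] = A && C)%N.
  under eq_bigr => z _ do rewrite andbCA.
  exact: (sum_eq_op w (fun=> A && C)).
have drop_eq2 (w w' : T) C : (\sum_y \sum_z [&& w == y, w' == z & C] = C)%N.
  by under eq_bigr do rewrite drop_eq; rewrite -[RHS](drop_eq true w).
have fixed_swapped : (\sum_x \sum_y \sum_z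
    [&& s x == x, s y == z, s y != y & s (s y) == y] = f 1 * (f 2 - f 1))%N.
  rewrite -c2 -c1 -sumM; apply: eq_bigr => x _; apply: eq_bigr => y _.
  exact: drop_eq.
have cycle3 : (\sum_x \sum_y \sum_z
    [&& s x == y, s (s x) == z, s x != x & s (s (s x)) == x] = f 3 - f 1)%N.
  by rewrite -c3; apply: eq_bigr => x _; apply: drop_eq2.
rewrite fixed_swapped cycle3.
(* The remaining patterns are the two already summed with the points renamed, so exchanging sums
   suffices. *)
have -> : (\sum_x \sum_y \sum_z
    [&& s y == y, s z == x, s z != z & s (s z) == z] = f 1 * (f 2 - f 1))%N.
  rewrite -fixed_swapped exchange_big; apply: eq_bigr => y _.
  by rewrite exchange_big.
have -> : (\sum_x \sum_y \sum_z
    [&& s z == z, s x == y, s x != x & s (s x) == x] = f 1 * (f 2 - f 1))%N.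
  rewrite -fixed_swapped [RHS]exchange_big; apply: eq_bigr => x _ /=.
  by rewrite exchange_big.
have -> : (\sum_x \sum_y \sum_z
    [&& s x == z, s (s x) == y, s x != x & s (s (s x)) == x] = f 3 - f 1)%N.
  by rewrite -cycle3; apply: eq_bigr => x _; rewrite exchange_big.
lia.
Qed.

End StableTriples.

(** * Explicit polynomials from lists of terms *)

Section LeftAssociatedForm.

Variables (R : nzRingType) (X : nat -> R).
Implicit Types (v : nat * nat) (w : nat * seq (nat * nat)).

Definition monomial (l : seq (nat * nat)) : R := \prod_(v <- l) X v.1 ^+ v.2.

(* The terms are written here exactly as in a left-associated sum of products,
   without unit factors or exponents, so that an explicit polynomial is
   convertible to [explicit_sum] of its list of terms. *)
Definition explicit_power v : R :=
  if v.2 is 1 then X v.1 else X v.1 ^+ v.2.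

Definition explicit_term w : R :=
  if w.2 is v :: l then
    foldl (fun P u => P * explicit_power u)
      (if w.1 is 1 then explicit_power v else w.1%:R * explicit_power v) l
  else w.1%:R.

Definition explicit_sum (l : seq (nat * seq (nat * nat))) : R :=
  if l is w :: l' then
    foldl (fun P u => P + explicit_term u) (explicit_term w) l'
  else 0.

Lemma explicit_termE w : explicit_term w = monomial w.2 *+ w.1.
Proof.
have powerE v : explicit_power v = X v.1 ^+ v.2.
  by case: v => k [|[|e]]; rewrite /explicit_power //= expr1.
have foldlE P l : foldl (fun P u => P * explicit_power u) P l =
    P * monomial l.
  elim: l P => [|v l IHl] P; rewrite /monomial /= ?big_nil ?mulr1 //.
  by rewrite IHl big_cons powerE mulrA.
case: w => m [|v l]; rewrite /explicit_term /=.
  by rewrite /monomial big_nil.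
rewrite foldlE /monomial big_cons -powerE -mulrnAl; congr (_ * _).
by case: m => [|[|m]]; rewrite ?mulr1n // mulr_natl.
Qed.

Lemma explicit_sumE l :
  explicit_sum l = \sum_(w <- l) monomial w.2 *+ w.1.
Proof.
have foldlE P l' : foldl (fun P u => P + explicit_term u) P l' =
    P + \sum_(w <- l') monomial w.2 *+ w.1.
  elim: l' P => [|w l' IHl] P /=; first by rewrite big_nil addr0.
  by rewrite IHl big_cons explicit_termE addrA.
case: l => [|w l] /=; first by rewrite big_nil.
by rewrite foldlE big_cons explicit_termE.
Qed.

End LeftAssociatedForm.

(** * Recovering cycle lengths from fixed-point counts, by computable lists *)

Section OrbitCountLists.

Variable T : finType.
Implicit Types (s : {perm T}) (c : seq nat).

(* The entry at index [d] counts the points, not the cycles, in cycles of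
   length [d]. *)
Definition orbit_counts n s : seq nat := mkseq (orbit_count s) n.

Definition fixed_points c m : nat :=
  sumn [seq nth 0%N c d | d <- iota 0 (size c) & (d %| m)%N].

Lemma fixed_pointsE n s m :
  fixed_points (orbit_counts n s) m =
  (\sum_(d < n | (d %| m)%N) orbit_count s d)%N.
Proof.
rewrite /fixed_points sumnE big_map big_filter size_mkseq.
rewrite -{1}[n]subn0 -/(index_iota 0 n) big_mkord.
by apply: eq_bigr => d _; rewrite nth_mkseq.
Qed.

Lemma fixed_points_fix_count n s m : (0 < m)%N -> (#|T| < n)%N ->
  fixed_points (orbit_counts n s) m = fix_count s m.
Proof.
move=> m_gt0 lt_n; rewrite fixed_pointsE -fix_countE //.
exact: leq_ltn_trans (geq_minr _ _) lt_n.
Qed.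

(** Recursive Möbius inversion: the list [c] ends just before index [n], so [fixed_points c n] sums
    over the proper divisors of [n] and the difference is the entry at [n]. *)
Fixpoint counts_of_fix (F : nat -> nat) n : seq nat :=
  if n is n'.+1 then
    let c := counts_of_fix F n' in rcons c (F n - fixed_points c n)%N
  else [:: 0%N].

Lemma counts_of_fixE (F : nat -> nat) n s :
  (forall m, (0 < m)%N -> F m = fix_count s m) ->
  counts_of_fix F n = orbit_counts n.+1 s.
Proof.
move=> FE; elim: n => [|n IHn]; first by congr (_ :: _); rewrite orbit_count0.
rewrite [RHS](mkseqS (orbit_count s) n.+1) [LHS]/= IHn; congr rcons.
(* With the bound [n.+2] the last summand is the length [n.+1] being solved for. *)
rewrite FE // (@fix_countE _ _ _ n.+2) // ?ltnS ?geq_minl //.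
by rewrite big_mkcond big_ord_recr /= dvdnn -big_mkcond fixed_pointsE addKn.
Qed.

(** Zero exponents are left out, so that the list has the shape of a term written by hand. *)
Definition cycle_list c : seq (nat * nat) :=
  [seq (k, nth 0 c k %/ k)%N | k <- iota 1 (size c).-1
                             & (nth 0 c k %/ k != 0)%N].

Lemma prod_ncycles n s :
  \prod_(1 <= k < n.+1) a k ^+ ncycles k s =
  monomial a (cycle_list (orbit_counts n.+1 s)).
Proof.
rewrite /monomial big_map big_filter size_mkseq -[n.+1.-1](subn1 n.+1).
rewrite [RHS]big_mkcond; apply: eq_big_nat => k /andP[_ lt_kn].
by rewrite nth_mkseq // -ncyclesE; case: eqP => // ->; rewrite expr0.
Qed.

End OrbitCountLists.

(** * Merging equal entries of weighted lists *)

Section WeightedLists.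

Variables (A : eqType) (V : nmodType).
Implicit Types (w : nat * A) (l : seq (nat * A)).

Fixpoint add_weight w l :=
  if l is v :: l' then
    if v.2 == w.2 then (v.1 + w.1, v.2)%N :: l' else v :: add_weight w l'
  else [:: w].

(** Keeps the census at one entry per cycle type. Weight 0 arises from insertion into a cycle length
    that does not occur, where the computed counts are meaningless. *)
Definition collect l :=
  foldr add_weight [::] [seq w <- l | w.1 != 0%N].

Lemma big_collect (g : A -> V) l :
  \sum_(w <- collect l) g w.2 *+ w.1 = \sum_(w <- l) g w.2 *+ w.1.
Proof.
have addE w l' : \sum_(v <- add_weight w l') g v.2 *+ v.1 =
    g w.2 *+ w.1 + \sum_(v <- l') g v.2 *+ v.1.
  elim: l' => [|v l' IH] /=; first by rewrite big_seq1 big_nil addr0.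
  case: eqP => [vw | _]; rewrite !big_cons /=.
    by rewrite mulrnDr {1}vw vw addrA [X in X + _]addrC.
  by rewrite IH addrCA.
rewrite /collect; elim: l => [|[[|m] t] l IH] /=; rewrite ?big_cons //=.
  by rewrite IH add0r.
by rewrite addE IH.
Qed.

End WeightedLists.

(** * Census of the cycle types of the symmetric group *)

Section CycleTypeCensus.

Variable n : nat.
Implicit Types (s : {perm 'I_n}) (c : seq nat) (k : nat).

Definition insert_counts c k : seq nat :=
  mkseq (fun i => nth 0 c i + k.+1 * (i == k.+1) - (i == 1) - k * (i == k))%N
        (size c).

(* [w.2] describes a permutation supported by [d] of the [n] points: the
   [n - d] remaining points are fixed and must be left out of the count of the
   possible places of insertion. *)
Definition census_step d (w : nat * seq nat) : seq (nat * seq nat) :=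
  w :: [seq (w.1 * (nth 0 w.2 k - (k == 1) * (n - d)), insert_counts w.2 k)%N
       | k <- iota 0 n.+1].

Fixpoint census d : seq (nat * seq nat) :=
  if d is d'.+1 then collect (flatten (map (census_step d') (census d')))
  else [:: (1%N, mkseq (fun i => (i == 1) * n)%N n.+1)].

Lemma orbit_counts_insert s x y : s x = x -> x != y ->
  orbit_counts n.+1 (s * tperm x y)%g =
  insert_counts (orbit_counts n.+1 s) #|porbit s y|.
Proof.
move=> sx xy; rewrite /insert_counts size_mkseq.
apply/eq_in_map => i; rewrite mem_iota => lt_i; rewrite nth_mkseq //.
exact: orbit_count_insert.
Qed.

(** The points outside [D] are fixed, so they matter only for [k = 1]. *)
Lemma card_orbit_length_on s (D : {set 'I_n}) k : perm_on D s ->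
  #|[set y in D | #|porbit s y| == k]| =
  (orbit_count s k - (k == 1) * (n - #|D|))%N.
Proof.
move=> sD; rewrite /orbit_count -[X in (_ = X - _)%N](cardsID D).
set E := [set z | _ == k]; have -> : #|E :\: D| = ((k == 1) * (n - #|D|))%N.
  rewrite -[n in (n - _)%N]card_ord -[#|'I_n|](cardsC D) addKn.
  case: (k =P 1%N) => [k1 | k1]; rewrite ?mul1n ?mul0n.
    apply: eq_card => z; rewrite !inE k1 andb_idr // => zD.
    by rewrite porbit_fix ?cards1 ?(out_perm sD).
  apply: eq_card0 => z; rewrite !inE; apply/negP => /andP[zD /eqP zk].
  by case: k1; rewrite -zk porbit_fix ?cards1 ?(out_perm sD).
by rewrite addnK; apply: eq_card => z; rewrite !inE andbC.
Qed.

(** An arbitrary [g] expresses that the weighted list is the distribution of the counts, and lets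
    the induction replace [g] by its total over one step. *)
Lemma sum_census (V : nmodType) (g : seq nat -> V) d : (d <= n)%N ->
  \sum_(s : {perm 'I_n} | perm_on [set i : 'I_n | (i < d)%N] s)
    g (orbit_counts n.+1 s) =
  \sum_(w <- census d) g w.2 *+ w.1.
Proof.
elim: d g => [| d IHd] g => [_ | lt_dn].
  rewrite big_seq1 (big_pred1 1%g) => [|s]; last first.
    apply/idP/eqP => [sD | ->]; last exact: perm_on1.
    apply: perm_on_id sD _; by rewrite (_ : [set i : 'I_n | _] = set0) ?cards0.
  congr g; apply: eq_mkseq => k; rewrite /orbit_count.
  rewrite (eq_card (B := [pred z : 'I_n | k == 1%N])) => [|z]; last first.
    by rewrite !inE porbit_fix ?perm1 // cards1 eq_sym.
  by case: (k == 1%N); rewrite ?card_ord ?mul1n //= ?eq_card0 // ?mul0n.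
pose x := Ordinal lt_dn; set D := [set i : 'I_n | (i < d)%N].
have DS : [set i : 'I_n | (i < d.+1)%N] = x |: D.
  by apply/setP => i; rewrite !inE ltnS leq_eqVlt.
have xD : x \notin D by rewrite inE ltnn.
have cardD : #|D| = d.
  rewrite -sum1_card; under eq_bigl do rewrite inE.
  by rewrite (big_ord_narrow (ltnW lt_dn)) sum1_card card_ord.
rewrite DS big_perm_onU1 //.
rewrite -[census _]/(collect (flatten (map (census_step d) (census d)))).
rewrite big_collect big_flatten big_map.
(* This total, started from [c] with weight 1, is where the induction hypothesis is applied. *)
pose h c := \sum_(v <- census_step d (1%N, c)) g v.2 *+ v.1.
rewrite (eq_bigr (fun w => h w.2 *+ w.1)) => [|[m c] _]; last first.
  rewrite /h [LHS]big_cons [in RHS]big_cons !big_map.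
  move: (iota 0 n.+1) => r /=; rewrite mulr1n mulrnDl; congr (_ + _).
  by rewrite -sumrMnl; apply: eq_bigr => k _; rewrite mul1n mulnC mulrnA.
rewrite -(IHd h (ltnW lt_dn)); apply: eq_bigr => s sD.
rewrite /h [RHS]big_cons big_map mulr1n; congr (_ + _).
rewrite -[X in iota 0 X]subn0 -/(index_iota 0 n.+1) big_mkord /=.
(* The new counts depend on [y] only through the length of its cycle; that length is at most [n], so
   [inord] preserves it. *)
rewrite (partition_big (fun y => inord #|porbit s y| : 'I_n.+1) predT) //=.
apply: eq_bigr => k _; rewrite mul1n nth_mkseq // -{1}cardD.
rewrite -card_orbit_length_on // -sumr_const.
have leP y : (#|porbit s y| < n.+1)%N.
  by rewrite ltnS -[X in (_ <= X)%N](card_ord n) max_card.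
apply: eq_big => [y | y /andP[yD /eqP <-]].
  by rewrite !inE -val_eqE /= inordK.
rewrite inordK // -(@orbit_counts_insert _ x) //; last first.
  by apply: contraNneq xD => ->.
exact: out_perm sD xD.
Qed.

Lemma sum_perm_census (V : nmodType) (g : seq nat -> V) :
  \sum_(s : {perm 'I_n}) g (orbit_counts n.+1 s) =
  \sum_(w <- census n) g w.2 *+ w.1.
Proof.
rewrite -sum_census //; apply: eq_bigl => s; symmetry.
by apply/subsetP => i _; rewrite inE ltn_ord.
Qed.

End CycleTypeCensus.

(** * The action on [r]-subsets and its faithfulness *)

Section InducedAction.

Variables p r : nat.
Implicit Types s : {perm 'I_p}.

Lemma card_rsubset : #|rsubset p r| = 'C(p, r).
Proof.
rewrite card_sig -[p in 'C(p, _)]card_ord -card_draws.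
by apply: eq_card => B; rewrite !inE.
Qed.

Lemma inducedX s m : induced r (s ^+ m)%g = (induced r s ^+ m)%g.
Proof. exact: (morphX (induced_morphism p r) m (in_setT s)). Qed.

Lemma fix_count_induced s m :
  fix_count (induced r s) m =
  #|[set B : {set 'I_p} | (#|B| == r) && ((s ^+ m)%g @: B == B)]|.
Proof.
rewrite /fix_count -(card_imset _ val_inj); apply: eq_card => B.
rewrite inE; apply/imsetP/andP => [[C + ->] | [Br sB]].
  by rewrite inE -inducedX permE -val_eqE /= => ->; rewrite (valP C).
exists (Sub B Br : rsubset p r) => //.
by rewrite inE -inducedX permE -val_eqE /=.
Qed.

(** If [s] and [t] differ at [x], take an [r]-set containing [x] but not the point that [t] sends to
    [s x]: only its image under [s] contains [s x]. *)
Lemma induced_injective : (0 < r < p)%N -> injective (@induced p r).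
Proof.
move=> /andP[r_gt0 lt_rp] s t est; apply/permP => x.
apply/eqP/negPn/negP => stx; set y := (t^-1)%g (s x).
have /negbTE yx : y != x.
  by apply: contra_neq stx => yx; rewrite -[X in t X]yx permKV.
(* The other [r.-1] points avoid [x] and [y]; this is possible because [r < p] leaves enough of the
   [p - 2] others. *)
have /set0Pn[C] : [set C : {set 'I_p} |
    C \subset ~: [set x; y] & #|C| == r.-1] != set0.
  rewrite -card_gt0 cards_draws bin_gt0.
  have := cardsC [set x; y]; rewrite card_ord cards2; lia.
rewrite inE => /andP[/subsetP sC /eqP cardC].
have /andP[xC yC] : (x \notin C) && (y \notin C).
  by rewrite -negb_or; apply/negP => /orP[] /sC; rewrite !inE eqxx ?orbT.
have cardB : #|x |: C| == r by rewrite cardsU1 xC cardC add1n prednK.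
pose B : rsubset p r := exist _ (x |: C) cardB.
have := congr1 (fun u : {perm _} => val (u B)) est.
move/setP/(_ (s x)).
rewrite !permE /= imset_f ?setU11 // => /esym/imsetP[z zB sxz].
have zy : z = y by rewrite /y sxz permK.
by move: zB; rewrite zy !inE (negbTE yC) orbF yx.
Qed.

End InducedAction.

(** * From cycle types on points to cycle types on triples *)

Section TripleAction.

Definition stable_triples f1 f2 f3 : nat :=
  ((f1 * f1.-1 * f1.-2 + 3 * (f1 * (f2 - f1)) + 2 * (f3 - f1)) %/ 6)%N.

(** The count of stable triples is applied to [s ^+ m], whose [k]-th power is [s ^+ (m * k)]. *)
Lemma fix_count_triples p (s : {perm 'I_p}) m (f := fix_count s) :
  fix_count (induced 3 s) m = stable_triples (f m) (f (m * 2)%N) (f (m * 3)%N).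
Proof.
have fX k : f (m * k)%N = fix_count (s ^+ m)%g k.
  by apply: eq_card => z; rewrite !inE expgM.
rewrite -[m in f m]muln1 !fX fix_count_induced /stable_triples.
by rewrite -card_stable_triples mulKn.
Qed.

Definition triple_counts n c : seq nat :=
  let f := fixed_points c in
  counts_of_fix (fun m => stable_triples (f m) (f (m * 2)%N) (f (m * 3)%N)) n.

Lemma triple_countsE p n (s : {perm 'I_p}) :
  triple_counts n (orbit_counts p.+1 s) = orbit_counts n.+1 (induced 3 s).
Proof.
apply: counts_of_fixE => m m_gt0.
rewrite !fixed_points_fix_count ?muln_gt0 ?m_gt0 ?card_ord //.
by rewrite fix_count_triples.
Qed.

Definition triple_census p n : seq (nat * seq (nat * nat)) :=
  [seq (w.1, cycle_list (triple_counts n w.2)) | w <- census p p].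

(** By faithfulness the group has order [p]! and the sum runs over all of the symmetric group; each
    summand depends only on the cycle type, so the census evaluates it. *)
Lemma cycle_index_rgroup3 p : (3 < p)%N ->
  cycle_index (rgroup p 3) = ((p`!)%:R^-1 : rat) *:
    \sum_(w <- triple_census p 'C(p, 3)) monomial a w.2 *+ w.1.
Proof.
move=> lt3p; have inj := @induced_injective p 3 lt3p.
have rgroupE : rgroup p 3 = @induced p 3 @: [set: {perm 'I_p}] :> {set _}.
  by rewrite /= morphimEdom.
have cardG : #|rgroup p 3| = p`!.
  by rewrite rgroupE card_imset // cardsT card_Sn.
rewrite /cycle_index cardG; congr (_ *: _); rewrite rgroupE.
rewrite big_imset => [|s t _ _] /=; last exact: inj.
under eq_bigl do rewrite inE.
under eq_bigr do rewrite card_rsubset prod_ncycles -triple_countsE.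
rewrite big_map -(@sum_perm_census p _ (fun c =>
  monomial a (cycle_list (triple_counts 'C(p, 3) c)))).
by [].
Qed.

End TripleAction.

(** * Evaluation for eight points *)

Definition S8_triple_terms : seq (nat * seq (nat * nat)) :=
  [:: (1, [:: (1, 56)]);
      (28, [:: (1, 26); (2, 15)]);
      (210, [:: (1, 12); (2, 22)]);
      (112, [:: (1, 11); (3, 15)]);
      (420, [:: (1, 6); (2, 25)]);
      (1120, [:: (1, 5); (2, 3); (3, 7); (6, 4)]);
      (420, [:: (1, 4); (2, 4); (4, 11)]);
      (1680, [:: (1, 3); (2, 4); (3, 3); (6, 6)]);
      (2520, [:: (1, 2); (2, 5); (4, 11)]);
      (1120, [:: (1, 2); (3, 18)]);
      (1120, [:: (1, 2); (3, 8); (6, 5)]);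
      (4032, [:: (1, 1); (5, 5); (10, 3)]);
      (3360, [:: (1, 1); (2, 1); (3, 1); (4, 2); (6, 1); (12, 3)]);
      (2688, [:: (1, 1); (5, 2); (15, 3)]);
      (1344, [:: (1, 1); (5, 11)]);
      (105, [:: (2, 28)]);
      (1260, [:: (2, 6); (4, 11)]);
      (3360, [:: (2, 1); (3, 2); (6, 8)]);
      (3360, [:: (2, 1); (6, 9)]);
      (1260, [:: (4, 14)]);
      (5760, [:: (7, 8)]);
      (5040, [:: (8, 7)])]%N.

(** Direct evaluation, up to order: the 22 terms correspond to the 22 partitions of 8. *)
Lemma S8_triple_census : perm_eq (triple_census 8 'C(8, 3)) S8_triple_terms.
Proof. by vm_compute. Qed.

Theorem mainTheorem4 :
  cycle_index (rgroup 8 3) =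
    ((8`!)%:R^-1 : rat) *:
    (
     a 1 ^+ 56 +
     28 * a 1 ^+ 26 * a 2 ^+ 15 +
     210 * a 1 ^+ 12 * a 2 ^+ 22 +
     112 * a 1 ^+ 11 * a 3 ^+ 15 +
     420 * a 1 ^+ 6 * a 2 ^+ 25 +
     1120 * a 1 ^+ 5 * a 2 ^+ 3 * a 3 ^+ 7 * a 6 ^+ 4 +
     420 * a 1 ^+ 4 * a 2 ^+ 4 * a 4 ^+ 11 +
     1680 * a 1 ^+ 3 * a 2 ^+ 4 * a 3 ^+ 3 * a 6 ^+ 6 +
     2520 * a 1 ^+ 2 * a 2 ^+ 5 * a 4 ^+ 11 +
     1120 * a 1 ^+ 2 * a 3 ^+ 18 +
     1120 * a 1 ^+ 2 * a 3 ^+ 8 * a 6 ^+ 5 +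
     4032 * a 1 * a 5 ^+ 5 * a 10 ^+ 3 +
     3360 * a 1 * a 2 * a 3 * a 4 ^+ 2 * a 6 * a 12 ^+ 3 +
     2688 * a 1 * a 5 ^+ 2 * a 15 ^+ 3 +
     1344 * a 1 * a 5 ^+ 11 +
     105 * a 2 ^+ 28 +
     1260 * a 2 ^+ 6 * a 4 ^+ 11 +
     3360 * a 2 * a 3 ^+ 2 * a 6 ^+ 8 +
     3360 * a 2 * a 6 ^+ 9 +
     1260 * a 4 ^+ 14 +
     5760 * a 7 ^+ 8 +
     5040 * a 8 ^+ 7
    ).
Proof.
rewrite cycle_index_rgroup3; last by [].
congr (_ *: _).
rewrite (perm_big _ S8_triple_census).
(* The explicit sum of the listed terms is the stated polynomial by conversion. *)
rewrite -[LHS](explicit_sumE a).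
reflexivity.
Qed.
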